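(* Let $\mathcal{W}$ be a periodic labeled wedge of period $p$ and preperiod $q$, with associated graph $\Gamma$ and finite model $\Gamma_1=\Gamma/\equiv_{p,q}$. Then the set of roots in the open unit disk $\mathbb{D}$ of the spectral determinant $P_\Gamma$ equals the set of roots in $\mathbb{D}$ of the spectral determinant $P_{\Gamma_1}$.
   Context: $\Sigma=\{(i,j)\in\mathbb{N}^2:1\le i\le j\}$; a labeled wedge is $\Phi:\Sigma\to\{N,S,E\}$. Its graph $\Gamma$: vertices $\Sigma$; no edges out of $E$-vertices; $(i,j)\to(i+1,j+1)$ out of $N$-vertices; $(i,j)\to(1,i+1)$ and $(i,j)\to(1,j+1)$ out of $S$-vertices. For $p\ge1,q\ge0$: $i\equiv_{p,q}j$ iff $i=j$ or ($\min\{i,j\}\ge q+1$ and $i\equiv j\bmod p$); on $\Sigma$, $(i,j)\equiv_{p,q}(k,l)$ iff ($i\equiv_{p,q}k$, $j\equiv_{p,q}l$) or ($i\equiv_{p,q}l$, $j\equiv_{p,q}k$). $\mathcal{W}$ is periodic of period $p$ and preperiod $q$ if equivalent vertices have equal labels and $(i,j)$ is labeled $E$ iff $i\equiv_{p,q}j$. $\Gamma_1$ is the quotient graph: vertices are $\equiv_{p,q}$-classes and the number of edges $[v]\to[w]$ is the number of edges from $v$ to members of $[w]$. In a directed graph, a simple cycle is a closed path without self-intersection, up to cyclic permutation; a multicycle is a finite union (possibly empty) of simple cycles with pairwise disjoint vertex sets; its length $\ell(\gamma)$ is the total number of edges and $C(\gamma)$ its number of simple cycles. The spectral determinant is $P(t)=\sum_{\gamma}(-1)^{C(\gamma)}t^{\ell(\gamma)}$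 over all multicycles. For $\Gamma$ there are finitely many multicycles of each length and $P_\Gamma$ converges to a holomorphic function on $\mathbb{D}$; for the finite graph $\Gamma_1$, $P_{\Gamma_1}(t)=\det(I-tA)$ with $A$ its adjacency matrix. *)

(* Defs.v *)
From mathcomp Require Import all_boot all_order all_algebra finmap.
From mathcomp Require Import boolp classical_sets fsbigop reals topology normedtype sequences.
From mathcomp Require Import complex.
Import Order.TTheory GRing.Theory Num.Theory numFieldNormedType.Exports.

Set Implicit Arguments.
Unset Strict Implicit.
Unset Printing Implicit Defensive.

Local Open Scope classical_set_scope.
Local Open Scope ring_scope.
Local Open Scope complex_scope.

Inductive label := LN | LS | LE.

Definition vertex := (nat * nat)%type.

Definition inSigma (v : vertex) : bool := (1 <= v.1)%N && (v.1 <= v.2)%N.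

(* A labeled wedge Phi : Sigma -> {N,S,E}; only its values on Sigma matter. *)
Definition wedge := vertex -> label.

Definition out_edges (Phi : wedge) (v : vertex) : seq vertex :=
  match Phi v with
  | LN => [:: (v.1.+1, v.2.+1)]
  | LS => [:: (1%N, v.1.+1); (1%N, v.2.+1)]
  | LE => [::]
  end.

Definition edge (Phi : wedge) (v w : vertex) : bool :=
  inSigma v && (w \in out_edges Phi v).

Definition eqpq (p q i j : nat) : bool :=
  (i == j) || ((q.+1 <= minn i j)%N && (i == j %[mod p])).

Definition veq (p q : nat) (v w : vertex) : bool :=
  (eqpq p q v.1 w.1 && eqpq p q v.2 w.2) || (eqpq p q v.1 w.2 && eqpq p q v.2 w.1).

Definition periodic_wedge (Phi : wedge) (p q : nat) : Prop :=
  [/\ (1 <= p)%N,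
      (forall v w, inSigma v -> inSigma w -> veq p q v w -> Phi v = Phi w)
    & (forall v, inSigma v -> (Phi v = LE <-> eqpq p q v.1 v.2))].

(* A simple cycle is a closed path without self-intersection, up to cyclic
   permutation: we represent it by the (finite) set of all cyclic rotations
   of a vertex sequence s = [v_0; ...; v_{k-1}] with pairwise distinct
   vertices and edges v_m -> v_{m+1 mod k}. *)
Definition rotclass (s : seq vertex) : {fset seq vertex} :=
  [fset rot k s | k in iota 0 (size s)]%fset.

Definition simple_cycle (Phi : wedge) (c : {fset seq vertex}) : Prop :=
  exists s : seq vertex,
    [/\ s != [::], all inSigma s, ucycle (edge Phi) s & c = rotclass s].

(* Number of edges of a simple cycle (= size of any representative). *)
Definition cycle_length (c : {fset seq vertex}) : nat :=
  size (head [::] (enum_fset c)).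

Definition multicycle (Phi : wedge) (M : {fset {fset seq vertex}}) : Prop :=
  (forall c, c \in M -> simple_cycle Phi c) /\
  (forall c1 c2, c1 \in M -> c2 \in M -> c1 != c2 ->
     forall s1 s2, s1 \in c1 -> s2 \in c2 ->
       forall v, v \in s1 -> v \notin s2).

Definition mc_length (M : {fset {fset seq vertex}}) : nat :=
  (\sum_(c <- enum_fset M) cycle_length c)%N.

Definition spec_coef (Phi : wedge) (n : nat) : int :=
  \sum_(M \in [set M | multicycle Phi M /\ mc_length M = n])
     ((-1) ^+ #|` M| : int).

(* "P_Gamma(t) = z": the power series sum_n spec_coef n * t^n converges to z
   (P_Gamma(t) is defined, for t in the unit disk, as the sum of this
   series). *)
Definition PGamma_at (R : realType) (Phi : wedge) (t z : R[i]) : Prop :=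
  series (fun n => ((spec_coef Phi n)%:~R * t ^+ n : R[i]^o)) @ \oo
    --> (z : R[i]^o).

(* Every =_{p,q}-class of Sigma contains exactly one vertex (a,b) with
   1 <= a <= b <= q + p (each i is equivalent to exactly one element of
   {1,...,q+p}); we index the classes by these representatives, encoded as
   pairs of ordinals (a-1, b-1). *)
Definition cls (p q : nat) := {x : 'I_(q + p) * 'I_(q + p) | (x.1 <= x.2)%N}.

Definition cls_rep (p q : nat) (x : cls p q) : vertex :=
  ((val x).1.+1, (val x).2.+1).

(* Number of edges from the class [v] to the class [w]: number of edges from
   (the representative of) v to members of [w]. *)
Definition qcount (Phi : wedge) (p q : nat) (v w : cls p q) : nat :=
  count (fun u => veq p q u (cls_rep w)) (out_edges Phi (cls_rep v)).

Definition adj1 (R : realType) (Phi : wedge) (p q : nat)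
  : 'M[R[i]]_#|{: cls p q}| :=
  \matrix_(i, j) (qcount Phi (enum_val i) (enum_val j))%:R.

Definition PGamma1 (R : realType) (Phi : wedge) (p q : nat) (t : R[i]) : R[i] :=
  \det (1%:M - t *: adj1 R Phi p q).

(* Main.v *)
Require Import Defs.
From mathcomp Require Import all_boot all_order all_algebra finmap.
From mathcomp Require Import fingroup perm.
From mathcomp Require Import boolp classical_sets functions cardinality fsbigop.
From mathcomp Require Import reals topology normedtype sequences.
From mathcomp Require Import complex.
Import Order.TTheory GRing.Theory Num.Theory numFieldNormedType.Exports.

(** Truncate Gamma to a finite grid; the coefficients of P_Gamma are those
of det(1 - X G), G the adjacency matrix of the grid.  Let A be the adjacency
matrix of the graph of *ordered* pairs of residues, a two-fold cover of Gamma_1,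
and F its part made of N-edges and of the forward S-edges (i,j) -> (1,j+1).
Glue A's vertices on top of the grid, forward edges F staying on top and backward
S-edges falling back into the grid.  The glued graph covers the ordered graph, and
the complementary factor of its determinant is that of an acyclic (height
increasing) graph, i.e. 1; on the other hand, modulo a high power of X no cycle
can use both parts.  Hence P_Gamma * det(1 - X F) = det(1 - X A) as formal power
series.  Every vertex has at most one F-edge, so det(1 - t F) has no zero in the
unit disk; and antisymmetric functions of ordered pairs only see N-edges, so
det(1 - t A) and det(1 - t A_1) have the same zeros there. *)

Set Implicit Arguments.
Unset Strict Implicit.
Unset Printing Implicit Defensive.
Local Open Scope ring_scope.
Local Open Scope complex_scope.

(** * Determinants *)

(** A row vector [v] with [v = t v F] has l1-norm at most [|t|] times itself, since the rows of [F]
    have l1-norm at most 1; hence [v = 0]. *)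
Lemma det_substochastic_neq0 (C : numFieldType) (n : nat) (F : 'M[C]_n) (t : C) :
  (forall i, \sum_j `|F i j| <= 1) -> `|t| < 1 -> \det (1%:M - t *: F) != 0.
Proof.
move=> F1 t1; apply/negP => /det0P[v v0]; rewrite mulmxBr mulmx1 -scalemxAr.
move/eqP; rewrite subr_eq0 => /eqP vE.
have vj j : `|v 0 j| <= `|t| * \sum_i `|v 0 i| * `|F i j|.
  rewrite {1}vE !mxE normrM ler_wpM2l//.
  by rewrite (le_trans (ler_norm_sum _ _ _))// ler_sum// => i _; rewrite normrM.
have S0 : \sum_j `|v 0 j| <= `|t| * \sum_j `|v 0 j|.
  apply: (le_trans (ler_sum _ (fun j _ => vj j))).
  rewrite -mulr_sumr ler_wpM2l// exchange_big/= ler_sum// => i _.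
  by rewrite -mulr_sumr ler_piMr.
have Sge : 0 <= \sum_j `|v 0 j| by apply: sumr_ge0.
have : \sum_j `|v 0 j| = 0.
  apply/eqP; rewrite eq_le Sge andbT; move: S0.
  by rewrite -subr_le0 -{1}[\sum__ _]mul1r -mulrBl pmulr_rle0// subr_gt0.
move/psumr_eq0P => v00; case/eqP: v0; apply/rowP => j.
by rewrite mxE; apply/eqP; rewrite -normr_eq0 v00.
Qed.

(** A permutation with no vanishing factor in the Leibniz expansion never decreases [key]. As it
    preserves the sum of the keys, it preserves every key, so it moves no point. *)
Lemma det_strictly_increasing (C : comNzRingType) (n : nat) (E : 'M[C]_n)
    (key : 'I_n -> nat) :
  (forall i j, E i j != 0 -> (key i < key j)%N) -> \det (1%:M - E) = 1.
Proof.
move=> Ekey; rewrite /determinant (bigD1 1%g)//= [X in _ + X]big1 => [|s s1].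
  rewrite addr0 odd_perm1 mul1r big1// => i _; rewrite perm1 !mxE eqxx.
  by have [->|/Ekey] := eqVneq (E i i) 0; rewrite ?subr0 ?ltnn.
suff [i /eqP Ei] : exists i, (1%:M - E) i (s i) == 0.
  by rewrite (bigD1 i)//= Ei mul0r mulr0.
apply/existsP; apply: contraR s1; rewrite negb_exists => /forallP Es.
have key_le i : (key i <= key (s i))%N.
  have := Es i; rewrite !mxE; have [<-|sii] := eqVneq i (s i); first by rewrite leqnn.
  by rewrite mulr0n sub0r oppr_eq0 => /Ekey/ltnW.
(* Reindexing by [s] shows both sums of keys to be equal, which forces equality in each
   inequality. *)
have ks : [forall (i | true), key i == key (s i)].
  have := leqif_sum (fun i (_ : true) => conj (key_le i) (erefl (key i == key (s i)))).
  case=> _ <-; apply/eqP; exact: (reindex_inj (@perm_inj _ s)).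
apply/eqP/permP => i; rewrite perm1.
apply/esym/eqP; apply: contraT => sii.
have := Es i; rewrite !mxE (negPf sii) mulr0n sub0r oppr_eq0 => /Ekey.
by rewrite (eqP (implyP (forallP ks i) isT)) ltnn.
Qed.

(* [col_mx 1 P] intertwines the block matrix with [B]: the space it spans is
   invariant, and [A - P *m W] is the action on the quotient. *)
Lemma det_block_quotient (C : comNzRingType) (m1 m2 : nat) (x : C)
    (F : 'M[C]_m1) (W : 'M[C]_(m1, m2)) (U : 'M[C]_(m2, m1)) (A : 'M[C]_m2)
    (P : 'M[C]_(m2, m1)) (B : 'M[C]_m1) :
  F + W *m P = B -> U + A *m P = P *m B ->
  \det (1%:M - x *: block_mx F W U A) =
  \det (1%:M - x *: B) * \det (1%:M - x *: (A - P *m W)).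
Proof.
move=> FB UB; pose L (Q : 'M[C]_(m2, m1)) := block_mx 1%:M 0 Q 1%:M : 'M[C]_(m1 + m2).
have detL Q : \det (L Q) = 1 by rewrite det_lblock !det1 mulr1.
rewrite -(det_ublock _ (- (x *: W))); set M := (_ - _ in LHS).
(* Conjugation by the unipotent [L P]; the two hypotheses make the lower left block vanish. *)
have -> : \det M = \det (L (- P) *m M *m L P).
  by rewrite !det_mulmx !detL mul1r mulr1.
congr (\det _); rewrite /M mulmxBr mulmx1 mulmxBl -scalemxAr -scalemxAl /L !mulmx_block.
rewrite !mul0mx !mulmx0 !mul1mx !mulmx1 !addr0 !add0r addNr FB mulNmx.
have -> : - (P *m F) + U + (- P *m W + A) *m P = 0.
  by rewrite mulmxDl addrACA UB -FB mulmxDr !mulNmx mulmxA -opprD addNr.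
rewrite scale_block_mx opp_block_mx add_block_mx scaler0 subrr sub0r.
by rewrite mulNmx [- (P *m W) + A]addrC.
Qed.

Lemma det_eqmod (K : fieldType) (d : {poly K}) (n : nat) (A B : 'M[{poly K}]_n) :
  (forall i j, d %| A i j - B i j)%R -> (d %| \det A - \det B)%R.
Proof.
move=> AB; rewrite /determinant -sumrB.
apply: (big_ind (fun z => d %| z)) => [|x y|s _]; [exact: dvdp0|exact: dvdp_add|].
rewrite -mulrBr dvdp_mull//.
apply: (big_ind2 (fun x y => d %| x - y)) => [|x1 x2 y1 y2 dx dy|i _//].
  by rewrite subrr dvdp0.
have -> : x1 * y1 - x2 * y2 = (x1 - x2) * y1 + x2 * (y1 - y2).
  by rewrite mulrBl mulrBr subrKA.
by apply: dvdp_add; [apply: dvdp_mulr|apply: dvdp_mull].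
Qed.

(** Similarity by a diagonal matrix, stated without inverses: the weights will be powers of ['X],
    which are not units but can be cancelled. *)
Lemma det_diag_conj (D : idomainType) (n : nat) (d : 'I_n -> D)
    (A B : 'M[D]_n) :
  (forall i, d i != 0) -> (forall i j, A i j * d j = d i * B i j) ->
  \det A = \det B.
Proof.
move=> d0 AB; pose S := diag_mx (\row_j d j).
have : A *m S = S *m B.
  by apply/matrixP => i j; rewrite mul_mx_diag mul_diag_mx !mxE.
move/(congr1 determinant); rewrite !det_mulmx mulrC; apply: mulfI.
rewrite det_diag; apply/prodf_neq0 => i _; rewrite mxE; exact: d0.
Qed.

(* Conjugating by the diagonal weights [X^h] makes the upper right block vanish
   modulo [X^n]. *)
Lemma det_block_eqmod (K : fieldType) (m1 m2 n : nat) (h : 'I_m2 -> nat)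
    (A : 'M[{poly K}]_m1) (B : 'M[{poly K}]_(m1, m2))
    (C : 'M[{poly K}]_(m2, m1)) (D : 'M[{poly K}]_m2) :
  (forall i j, 'X^(h i) %| C i j)%R ->
  (forall i j, 'X^(h i) %| D i j * 'X^(h j))%R ->
  (forall i j, 'X^n %| B i j * 'X^(h j))%R ->
  ('X^n %| \det (block_mx A B C D) - \det A * \det D)%R.
Proof.
move=> hC hD hB.
have X0 k : 'X^k != 0 :> {poly K} by rewrite monic_neq0 ?monicXn.
(* These divisions, and those in [C'], are exact by [hD] and [hC]. *)
pose D' : 'M[{poly K}]_m2 := \matrix_(i, j) (D i j * 'X^(h j) %/ 'X^(h i))%R.
pose C' : 'M[{poly K}]_(m2, m1) := \matrix_(i, j) (C i j %/ 'X^(h i))%R.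
pose B' : 'M[{poly K}]_(m1, m2) := \matrix_(i, j) (B i j * 'X^(h j)).
have -> : \det D = \det D'.
  apply: (det_diag_conj (d := fun i => 'X^(h i))) => // i j.
  by rewrite !mxE mulrC [RHS]mulrC divpK// mulrC.
pose d (i : 'I_(m1 + m2)) : {poly K} :=
  match fintype.split i with inl _ => 1 | inr j => 'X^(h j) end.
have -> : \det (block_mx A B C D) = \det (block_mx A B' C' D').
  apply: (det_diag_conj (d := d)) => [i|i j].
    by rewrite /d; case: fintype.split => // _; rewrite oner_neq0.
  rewrite /d -(fintype.splitK i) -(fintype.splitK j).
  case: (fintype.split i) => k; case: (fintype.split j) => l /=;
    rewrite ?(fintype.unsplitK (inl k)) ?(fintype.unsplitK (inl l))
      ?(fintype.unsplitK (inr k)) ?(fintype.unsplitK (inr l))/=.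
  - by rewrite !block_mxEul mulr1 mul1r.
  - by rewrite !block_mxEur mxE mul1r.
  - by rewrite !block_mxEdl mxE mulr1 mulrC divpK.
  - by rewrite !block_mxEdr mxE [RHS]mulrC divpK.
rewrite -(det_lblock _ C'); apply: det_eqmod => i j.
rewrite -(fintype.splitK i) -(fintype.splitK j).
case: (fintype.split i) => k; case: (fintype.split j) => l /=.
- by rewrite !block_mxEul subrr dvdp0.
- by rewrite !block_mxEur !mxE subr0.
- by rewrite !block_mxEdl subrr dvdp0.
- by rewrite !block_mxEdr subrr dvdp0.
Qed.

(** * Matrices indexed by finite types *)

Definition enum_mx (C : Type) (T1 T2 : finType) (f : T1 -> T2 -> C) :
    'M[C]_(#|T1|, #|T2|) :=
  \matrix_(i, j) f (enum_val i) (enum_val j).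

Lemma sum_enum_val (C : nmodType) (T : finType) (f : T -> C) :
  \sum_(i < #|T|) f (enum_val i) = \sum_x f x.
Proof.
rewrite (reindex (@enum_val T T)) //=; last exact/onW_bij/enum_val_bij.
Qed.

Lemma mul_enum_mx (C : pzSemiRingType) (T1 T2 T3 : finType)
    (f : T1 -> T2 -> C) (g : T2 -> T3 -> C) :
  enum_mx f *m enum_mx g = enum_mx (fun x z => \sum_y f x y * g y z).
Proof.
apply/matrixP => i k; rewrite !mxE -[RHS]sum_enum_val.
by apply: eq_bigr => j _; rewrite !mxE.
Qed.

Lemma det_enum_mx_eq0P (C : idomainType) (T : finType) (t : C) (f : T -> T -> C) :
  reflect (exists2 x : T -> C, (exists v, x v != 0) &
                               forall v, x v = t * \sum_w f v w * x w)
          (\det (1%:M - t *: enum_mx f) == 0).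
Proof.
(* [det0P] speaks of row vectors; the transpose turns them into functions on which the matrix acts
   from the left. *)
rewrite -det_tr; apply: (iffP det0P) => [[x x0]|[x [v xv] xE]].
  move/(congr1 trmx); rewrite trmx_mul trmxK trmx0 mulmxBl mul1mx -scalemxAl.
  move/eqP; rewrite subr_eq0 => /eqP xE.
  exists (fun v => x 0 (enum_rank v)).
    have [j] : exists j, x 0 j != 0.
      apply/existsP; apply: contraR x0; rewrite negb_exists => /forallP x0.
      by apply/eqP/rowP => j; rewrite mxE; apply/eqP; have := x0 j; rewrite negbK.
    by exists (enum_val j); rewrite enum_valK.
  move=> v; have := congr1 (fun M : 'cV_ _ => M (enum_rank v) 0) xE.
  rewrite !mxE => ->; congr (_ * _); rewrite -[RHS]sum_enum_val; apply: eq_bigr => j _.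
  by rewrite !mxE enum_rankK enum_valK.
exists (\row_j x (enum_val j)).
  apply: contraNneq xv => /rowP/(_ (enum_rank v)).
  by rewrite !mxE enum_rankK => ->.
apply: trmx_inj; rewrite trmx_mul trmxK trmx0 mulmxBl mul1mx -scalemxAl.
apply/eqP; rewrite subr_eq0; apply/eqP/colP => i; rewrite !mxE xE.
congr (_ * _); rewrite -[LHS]sum_enum_val; apply: eq_bigr => j _.
by rewrite !mxE.
Qed.

Lemma sum_count_mem (C : pzSemiRingType) (T : finType) (s : seq T) (f : T -> C) :
  \sum_w (count_mem w s)%:R * f w = \sum_(u <- s) f u.
Proof.
elim: s => [|u s IH]; first by rewrite big_nil big1// => w _; rewrite mul0r.
rewrite big_cons -IH.
transitivity (\sum_w ((u == w)%:R * f w + (count_mem w s)%:R * f w)).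
  by apply: eq_bigr => w _; rewrite /= natrD mulrDl.
rewrite big_split/=; congr (_ + _).
rewrite (bigD1 u)//= eqxx mul1r big1 ?addr0// => w /negPf wu.
by rewrite eq_sym wu mul0r.
Qed.

(** The row sums of an adjacency matrix are the out-degrees. *)
Lemma det_out_le1_neq0 (C : numFieldType) (T : finType) (L : T -> seq T) (t : C) :
  (forall u, (size (L u) <= 1)%N) -> `|t| < 1 ->
  \det (1%:M - t *: enum_mx (fun u u' => (count_mem u' (L u))%:R)) != 0.
Proof.
move=> L1; apply: det_substochastic_neq0 => i.
rewrite -[X in X <= _](_ : \sum_u' (count_mem u' (L (enum_val i)))%:R * 1 = _).
  by rewrite sum_count_mem big_tnth sumr_const card_ord (ler_nat _ _ 1).
rewrite -[LHS]sum_enum_val; apply: eq_bigr => j _.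
by rewrite mxE normr_nat mulr1.
Qed.

Lemma horner_det_enum_mx (C : comNzRingType) (T : finType) (f : T -> T -> nat) (t : C) :
  (\det (1%:M - 'X *: enum_mx (fun u v => (f u v)%:R : {poly C}))).[t] =
  \det (1%:M - t *: enum_mx (fun u v => (f u v)%:R)).
Proof.
rewrite -[LHS]/(horner_eval t _) -det_map_mx; congr (\det _).
apply/matrixP => i j; rewrite !mxE /= /horner_eval hornerD hornerN hornerM hornerX.
by rewrite -polyC_natr -[X in X.[t]]polyC_natr !hornerC.
Qed.

(** * Multicycles and permutations *)

Section SpectralExpansion.
Variables (C : comNzRingType) (m : nat) (e : rel 'I_m).

Definition partial_perm (x : 'S_m * {set 'I_m}) : bool :=
  perm_on x.2 x.1 && [forall v in x.2, e v (x.1 v)].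

(** In the Leibniz product, the set collects the rows where the term [- 'X * e] is chosen rather
    than the identity; in the other rows the permutation must fix the index. *)
Lemma det_rel_coef n :
  (\det (1%:M - 'X *: \matrix_(i, j) (e i j)%:R : 'M[{poly C}]_m))`_n =
  \sum_(x : 'S_m * {set 'I_m} | partial_perm x && (#|x.2| == n))
     (-1) ^+ x.1 * (-1) ^+ n.
Proof.
rewrite /determinant.
have expand (s : 'S_m) :
    (-1) ^+ s * \prod_i (1%:M - 'X *: \matrix_(i, j) (e i j)%:R : 'M[{poly C}]_m) i (s i)
    = \sum_(S : {set 'I_m} | partial_perm (s, S)) (-1) ^+ s * (- 'X) ^+ #|S|.
  transitivity ((-1) ^+ s * \prod_i (- 'X * (e i (s i))%:R + (i == s i)%:R : {poly C})).
    by congr (_ * _); apply: eq_bigr => i _; rewrite !mxE addrC mulNr.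
  rewrite bigA_distr mulr_sumr [RHS]big_mkcond/=; apply: eq_bigr => S _.
  rewrite /partial_perm/=; case: ifPn => [/andP[sS /forall_inP eS]|].
    congr (_ * _); rewrite -prodr_const [RHS]big_mkcond; apply: eq_bigr => i _.
    case: ifPn => [iS|iS]; first by rewrite eS// mulr1.
    by rewrite (out_perm sS iS) eqxx.
  rewrite negb_and => sS; apply/eqP.
  (* The product has a zero factor: at a moved point outside [S], or at a point of [S] with no edge
     to its image. *)
  suff [i /eqP Ei] : exists i, (if i \in S then - 'X * (e i (s i))%:R
      else (i == s i)%:R : {poly C}) == 0.
    by rewrite (bigD1 i)//= Ei mul0r mulr0.
  case/orP: sS => [sS|/forall_inPn[i iS] /negPf ei].
    have /existsP[i /andP[si iS]] : [exists i, (s i != i) && (i \notin S)].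
      apply: contraNT sS; rewrite negb_exists => /forallP sS.
      apply/fintype.subsetP => i si; have := sS i; rewrite negb_and !negbK.
      by case/orP => // sii; rewrite inE sii in si.
    by exists i; rewrite (negPf iS) [i == _]eq_sym (negPf si).
  by exists i; rewrite iS ei mulr0.
rewrite (eq_bigr _ (fun s _ => expand s)) pair_big_dep/= coef_sum [RHS]big_mkcondr/=.
apply: eq_big => [[s S]//|[s S] _ /=].
rewrite (exprNn 'X) -!(rmorph_sign (@polyC C)) mulrA -polyCM coefCM coefXn.
rewrite eq_sym; case: eqP => [->|_]; last by rewrite mulr0.
by rewrite mulr1.
Qed.

End SpectralExpansion.

(** * Orbits and the sign of a permutation *)

Section Orbits.
Variables (T : finType) (s : {perm T}).

(** Links the sets that determine the signature with the sequences that are cycles of a graph. *)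
Lemma porbit_orbit (x : T) : porbit s x =i orbit s x.
Proof.
move=> y; rewrite -fconnect_orbit; apply/porbitP/idP => [[i ->]|/iter_findex <-].
  by rewrite permX fconnect_iter.
by exists (findex s x y); rewrite permX.
Qed.

Lemma porbit_perm_on (S : {set T}) x y : perm_on S s -> x \in S ->
  y \in porbit s x -> y \in S.
Proof.
move=> sS xS /porbitP[i ->]; elim: i => [|i IH]; first by rewrite perm1.
by rewrite expgSr permM (perm_closed _ sS).
Qed.

Lemma card_porbits_perm_on (S : {set T}) : perm_on S s ->
  (#|porbits s| = #|porbit s @: S| + #|~: S|)%N.
Proof.
move=> sS; have s1 x : x \notin S -> porbit s x = [set x].
  move=> xS; apply/setP => y; rewrite inE; apply/porbitP/eqP => [[i ->]|->].
    by elim: i => [|i IH]; rewrite ?perm1// expgSr permM IH (out_perm sS).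
  by exists 0%N; rewrite perm1.
have -> : porbits s = porbit s @: S :|: porbit s @: ~: S.
  rewrite -imsetU finset.setUCr; apply/setP => B.
  by apply/imsetP/imsetP => -[x _ ->]; exists x.
rewrite cardsU (_ : _ :&: _ = finset.set0) ?cards0 ?subn0.
  congr (_ + _)%N; apply: card_in_imset => x y; rewrite !inE => xS yS.
  by rewrite !s1// => /set1_inj.
apply/setP => B; rewrite !inE; apply/andP => -[/imsetP[x xS ->] /imsetP[y]].
rewrite inE => yS; rewrite (s1 y)// => /setP/(_ x).
by rewrite porbit_id inE => /esym/eqP xy; rewrite -xy xS in yS.
Qed.

Lemma sum_card_porbits (S : {set T}) : perm_on S s ->
  (\sum_(B in porbit s @: S) #|B| = #|S|)%N.
Proof.
move=> sS; apply/esym/card_partition/and3P; split.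
- apply/eqP/setP => x; apply/bigcupP/idP => [[_ /imsetP[y yS ->]]|xS].
    exact: porbit_perm_on.
  by exists (porbit s x); [exact: imset_f|exact: porbit_id].
- apply/finset.trivIsetP => _ _ /imsetP[x _ ->] /imsetP[y _ ->] xy.
  rewrite -setI_eq0; apply/set0Pn => -[z]; rewrite inE => /andP[zx zy].
  rewrite -!eq_porbit_mem in zx zy.
  by case/eqP: xy; rewrite -(eqP zx) (eqP zy).
- by apply/imsetP => -[x _ /setP/(_ x)]; rewrite porbit_id inE.
Qed.

(** The signature has the parity of [#|T|] plus the number of orbits, and the singleton orbits
    outside [S] cancel against [#|~: S|]. This turns the Leibniz sign into one sign per cycle. *)
Lemma sign_perm_on (C : comNzRingType) (S : {set T}) : perm_on S s ->
  (-1) ^+ s * (-1) ^+ #|S| = (-1) ^+ #|porbit s @: S| :> C.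
Proof.
move=> sS; rewrite /odd_perm (card_porbits_perm_on sS) -(cardsC S) !oddD.
rewrite -[RHS]signr_odd -[_ ^+ #|S|]signr_odd -signr_addb; congr (_ ^+ _).
by case: (odd _); case: (odd _); case: (odd _).
Qed.

End Orbits.

(** * Rotation classes of sequences *)

Section Rotations.
Implicit Types s : seq vertex.

Lemma mem_rotclass s t : s != [::] ->
  reflect (exists k, t = rot k s) (t \in rotclass s).
Proof.
move=> s0; apply: (iffP idP) => [|[k ->]].
  by case/imfsetP => k /= _ ->; exists k.
have sz : (0 < size s)%N by rewrite lt0n size_eq0.
have [ks|sk] := ltnP k (size s).
  by apply/imfsetP; exists k => //=; rewrite mem_iota.
by rewrite rot_oversize//; apply/imfsetP; exists 0%N; rewrite ?rot0//= mem_iota.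
Qed.

Lemma rotclass_id s : s != [::] -> s \in rotclass s.
Proof. by move=> s0; apply/mem_rotclass => //; exists 0%N; rewrite rot0. Qed.

Lemma rotclass_rot k s : s != [::] -> rotclass (rot k s) = rotclass s.
Proof.
move=> s0; have sr j : rot j s != [::] by rewrite -size_eq0 size_rot size_eq0.
apply/fsetP => t; apply/mem_rotclass/mem_rotclass => // -[j ->].
  by rewrite rot_rot_add; eexists.
by rewrite -[X in rot j X](rotK k) /rotr rot_rot_add; eexists.
Qed.

(** Ensures that [cycle_length] reads an actual representative and not the default [[::]]. *)
Lemma head_rotclass s : s != [::] -> head [::] (enum_fset (rotclass s)) \in rotclass s.
Proof.
move=> /rotclass_id; move: (rotclass s) => c.
have cE : enum_fset c =i c by [].
by case: (enum_fset c) cE => [|y l] cE; rewrite -!cE// mem_head.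
Qed.

Lemma cycle_length_rotclass s : s != [::] -> cycle_length (rotclass s) = size s.
Proof.
move=> s0; have /(mem_rotclass _ s0)[k kE] := head_rotclass s0.
by rewrite /cycle_length kE size_rot.
Qed.

End Rotations.

(** * Bijection between partial permutations and multicycles *)

Section Multicycles.
Variables (Phi : wedge) (m n : nat) (e : rel 'I_m) (iota : 'I_m -> vertex).
Hypothesis iota_inj : injective iota.
Hypothesis e_edge : forall x y, e x y -> edge Phi (iota x) (iota y).
(** The finite graph has to see only the cycles of length at most [n]: their vertices, and all edges
    of the wedge leaving these towards the image of [iota]. *)
Hypothesis cycle_iota : forall s, s != [::] -> ucycle (edge Phi) s ->
  (size s <= n)%N ->
  {in s, forall v, exists x, iota x = v} /\
  (forall x y, iota x \in s -> edge Phi (iota x) (iota y) -> e x y).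

Definition perm_cycle (s : 'S_m) (x : 'I_m) : {fset seq vertex} :=
  rotclass (map iota (orbit s x)).

Definition perm_multicycle (x : 'S_m * {set 'I_m}) : {fset {fset seq vertex}} :=
  [fset perm_cycle x.1 v | v in x.2]%fset.

Lemma orbit_map_neq0 (s : 'S_m) x : map iota (orbit s x) != [::].
Proof. by rewrite -size_eq0 size_map size_orbit -lt0n fingraph.order_gt0. Qed.

Lemma mem_perm_cycle (s : 'S_m) x t v : t \in perm_cycle s x ->
  (iota v \in t) = (v \in porbit s x).
Proof.
move=> /(mem_rotclass _ (orbit_map_neq0 s x))[k ->].
by rewrite mem_rot mem_map// porbit_orbit.
Qed.

Lemma eq_perm_cycle (s : 'S_m) x y :
  (perm_cycle s x == perm_cycle s y) = (porbit s x == porbit s y).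
Proof.
apply/eqP/eqP => xy.
  apply/eqP; rewrite eq_porbit_mem -(mem_perm_cycle (t := map iota (orbit s x))).
    by rewrite mem_map// in_orbit.
  by rewrite -xy rotclass_id// orbit_map_neq0.
have xo : x \in orbit s y by rewrite -porbit_orbit -eq_porbit_mem xy.
have [k kE] := orbit_rot_cycle (cycle_orbit (@perm_inj _ s) y) (orbit_uniq s y) xo.
by rewrite /perm_cycle kE map_rot rotclass_rot// orbit_map_neq0.
Qed.

(** [perm_cycle] is constant along orbits; indexing by orbits instead makes it injective, as
    counting cycles and summing lengths require. Orbits are nonempty, so they never meet the default
    [fset0]. *)
Definition block_cycle (s : 'S_m) (B : {set 'I_m}) : {fset seq vertex} :=
  if [pick x in B] is Some x then perm_cycle s x else fset0.

Lemma block_cycle_porbit (s : 'S_m) x : block_cycle s (porbit s x) = perm_cycle s x.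
Proof.
rewrite /block_cycle; case: pickP => [y yx|/(_ x)]; last by rewrite porbit_id.
by apply/eqP; rewrite eq_perm_cycle eq_porbit_mem.
Qed.

Lemma perm_multicycleE (s : 'S_m) (S : {set 'I_m}) :
  perm_multicycle (s, S) = [fset block_cycle s B | B in porbit s @: S]%fset.
Proof.
apply/fsetP => c; apply/imfsetP/imfsetP => -[/= x xS ->].
  by exists (porbit s x); rewrite ?block_cycle_porbit//=; exact: imset_f.
by case/imsetP: xS => y yS ->; exists y; rewrite ?block_cycle_porbit.
Qed.

Lemma block_cycle_inj (s : 'S_m) (S : {set 'I_m}) :
  {in porbit s @: S &, injective (block_cycle s)}.
Proof.
move=> _ _ /imsetP[x _ ->] /imsetP[y _ ->]; rewrite !block_cycle_porbit => /eqP.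
by rewrite eq_perm_cycle => /eqP.
Qed.

Lemma card_perm_multicycle (s : 'S_m) (S : {set 'I_m}) :
  #|` perm_multicycle (s, S)| = #|porbit s @: S|.
Proof.
rewrite perm_multicycleE card_in_imfset/=; last exact: block_cycle_inj.
by rewrite -cardE.
Qed.

Lemma mc_length_perm_multicycle (s : 'S_m) (S : {set 'I_m}) : perm_on S s ->
  mc_length (perm_multicycle (s, S)) = #|S|.
Proof.
move=> sS; rewrite /mc_length perm_multicycleE big_imfset/=; last exact: block_cycle_inj.
rewrite -(sum_card_porbits sS) big_enum/=; apply: eq_bigr => _ /imsetP[x _ ->].
rewrite block_cycle_porbit cycle_length_rotclass ?orbit_map_neq0// size_map size_orbit.
by rewrite -[LHS]size_orbit -(card_uniqP (orbit_uniq s x)); apply: eq_card => y;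
  rewrite porbit_orbit.
Qed.

Lemma multicycle_perm_multicycle (x : 'S_m * {set 'I_m}) : partial_perm e x ->
  multicycle Phi (perm_multicycle x).
Proof.
case: x => s S /andP[/= sS /forall_inP eS]; split.
  move=> _ /imfsetP[x /= xS ->]; exists (map iota (orbit s x)); split => //.
  - exact: orbit_map_neq0.
  - apply/allP => _ /mapP[y yx ->].
    have /eS/e_edge/andP[]// : y \in S.
    by apply: (porbit_perm_on sS xS); rewrite ?porbit_orbit.
  rewrite /ucycle map_inj_uniq// orbit_uniq andbT.
  apply: (homo_cycle_in (P := mem S) (e := frel s)) (cycle_orbit (@perm_inj _ s) x).
    by move=> y z yS _ /= /eqP <-; apply: e_edge; exact: eS.
  by apply/allP => y yx; apply: (porbit_perm_on sS xS); rewrite ?porbit_orbit.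
move=> _ _ /imfsetP[x /= xS ->] /imfsetP[y /= yS ->] + s1 s2 s1x s2y v vs1.
rewrite eq_perm_cycle; apply: contraNN => vs2.
have [z vz] : exists z, v = iota z.
  move: s1x vs1 => /(mem_rotclass _ (orbit_map_neq0 s x))[k ->].
  by rewrite mem_rot => /mapP[z _ ->]; exists z.
move: vs1 vs2; rewrite vz (mem_perm_cycle _ s1x) (mem_perm_cycle _ s2y).
by rewrite -!eq_porbit_mem => /eqP <- /eqP <-.
Qed.

Lemma perm_multicycle_mem (x : 'S_m * {set 'I_m}) v : partial_perm e x ->
  (v \in x.2) <-> (exists c t, [/\ c \in perm_multicycle x, t \in c & iota v \in t]).
Proof.
case: x => s S /andP[/= sS _]; split => [vS|[c [t [/imfsetP[x /= xS ->] tx]]]].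
  exists (perm_cycle s v), (map iota (orbit s v)); split.
  - by apply/imfsetP; exists v.
  - by rewrite rotclass_id// orbit_map_neq0.
  - by rewrite mem_map// in_orbit.
by rewrite (mem_perm_cycle _ tx); apply: porbit_perm_on.
Qed.

Lemma perm_cycle_next (s : 'S_m) x t v : t \in perm_cycle s x -> iota v \in t ->
  next t (iota v) = iota (s v).
Proof.
move=> /(mem_rotclass _ (orbit_map_neq0 s x))[k ->]; rewrite mem_rot mem_map// => vx.
rewrite next_rot ?map_inj_uniq ?orbit_uniq// next_map ?orbit_uniq//.
by rewrite (nextE (cycle_orbit (@perm_inj _ s) x)).
Qed.

(** The multicycle determines the set as the vertices it visits, and the permutation as the
    successor along its cycles; elsewhere the permutation is the identity. *)
Lemma perm_multicycle_inj :
  {in partial_perm e &, injective perm_multicycle}.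
Proof.
move=> [s1 S1] [s2 S2] p1 p2 E.
have ES : S1 = S2.
  apply/setP => v; apply/idP/idP.
    by move/(perm_multicycle_mem v p1); rewrite E => /(perm_multicycle_mem v p2).
  by move/(perm_multicycle_mem v p2); rewrite -E => /(perm_multicycle_mem v p1).
congr pair => //; apply/permP => v.
have [vS|vS] := boolP (v \in S1); last first.
  move: p1 p2 => /andP[/= p1 _] /andP[/= p2 _].
  by rewrite (out_perm p1 vS) (out_perm p2)// -ES.
have : perm_cycle s1 v \in perm_multicycle (s2, S2).
  by rewrite -E; apply/imfsetP; exists v.
case/imfsetP => y /= yS2 vy.
have m1 : map iota (orbit s1 v) \in perm_cycle s1 v by rewrite rotclass_id ?orbit_map_neq0.
have vm : iota v \in map iota (orbit s1 v) by rewrite mem_map// in_orbit.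
apply: iota_inj; rewrite -(perm_cycle_next m1)//.
by rewrite vy in m1; rewrite -(perm_cycle_next m1).
Qed.

Lemma simple_cycle_rep c : simple_cycle Phi c ->
  exists t, [/\ t != [::], ucycle (edge Phi) t & c = rotclass t].
Proof. by move=> [t [t0 _ tc ->]]; exists t. Qed.

(** The permutation sends each vertex on a cycle of [M] to its successor and fixes all other
    vertices; disjointness of the cycles makes this well defined. *)
Lemma perm_multicycle_surj (M : {fset {fset seq vertex}}) :
  multicycle Phi M -> mc_length M = n ->
  exists2 x, partial_perm e x & perm_multicycle x = M.
Proof.
move=> [Msimple Mdisj] Mn.
have lenM c : c \in M -> (cycle_length c <= n)%N.
  by move=> cM; rewrite -Mn /mc_length (big_fsetD1 c)//= leq_addr.
have Mrep c : c \in M -> exists t, [/\ t != [::], ucycle (edge Phi) t, c = rotclass t &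
    {in t, forall v, exists x, iota x = v} /\
    (forall x y, iota x \in t -> edge Phi (iota x) (iota y) -> e x y)].
  move=> cM; have [t [t0 tc cE]] := simple_cycle_rep (Msimple c cM).
  exists t; split=> //; apply: cycle_iota => //.
  by rewrite -cycle_length_rotclass// -cE lenM.
pose on_cycle x t := exists2 c, c \in M & t \in c /\ iota x \in t.
have on_uniq x c t : c \in M -> t \in c -> iota x \in t -> forall c' t',
    c' \in M -> t' \in c' -> iota x \in t' -> c' = c.
  move=> cM tc xt c' t' c'M t'c' xt'; apply/eqP; apply: contraT => cc'.
  by have := Mdisj _ _ c'M cM cc' _ _ t'c' tc _ xt'; rewrite xt.
have succ_ex x : exists y,
    (forall c t, c \in M -> t \in c -> iota x \in t -> iota y = next t (iota x)) /\
    ((~ exists t, on_cycle x t) -> y = x).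
  have [[t [c cM [tc xt]]]|nx] := pselect (exists t, on_cycle x t); last first.
    exists x; split=> // c t cM tc xt; exfalso; apply: nx.
    by exists t, c.
  have [r [r0 ru cE [rim _]]] := Mrep c cM.
  have rt t' : t' \in c -> t' =i r /\ next t' =1 next r.
    rewrite cE => /(mem_rotclass _ r0)[k ->]; split; first exact: mem_rot.
    by apply: next_rot; case/andP: ru.
  have [y yE] : exists y, iota y = next r (iota x).
    by apply: rim; rewrite mem_next -(rt t tc).1.
  exists y; split=> [c' t' c'M t'c' xt'|[]]; last by exists t, c.
  have c'c := on_uniq _ _ _ cM tc xt _ _ c'M t'c' xt'.
  by rewrite yE (rt t' _).2// -c'c.
have [f fP] := boolp.choice succ_ex.
have next_on x c t : c \in M -> t \in c -> iota x \in t -> iota (f x) \in t.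
  by move=> cM tc xt; rewrite ((fP x).1 c t)// mem_next.
(* Both [x] and [f x] lie on the same cycle, where [next] is inverted by [prev]; a point off all
   cycles is its own image. *)
have f_inj : injective f.
  have half x y : f x = f y -> (exists t, on_cycle x t) -> x = y.
    move=> fxy [t [c cM [tc xt]]].
    have fxt := next_on _ _ _ cM tc xt.
    have [[t' [c' c'M [t'c' yt']]]|ny] := pselect (exists t, on_cycle y t); last first.
      exfalso; apply: (ny); exists t, c => //; split=> //.
      by rewrite -((fP y).2 ny) -fxy.
    have fyt := next_on _ _ _ c'M t'c' yt'; rewrite -fxy in fyt.
    have c'c := on_uniq _ _ _ cM tc fxt _ _ c'M t'c' fyt.
    have [r [r0 /andP[_ ru] cE _]] := Mrep c cM.
    have nr u : u \in c -> next u =1 next r.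
      by rewrite cE => /(mem_rotclass _ r0)[k ->]; apply: next_rot.
    apply: iota_inj; apply: (can_inj (prev_next ru)).
    rewrite -(nr t)// -((fP x).1 c)// fxy ((fP y).1 c' t')//.
    by rewrite nr// -c'c.
  move=> x y fxy; have [xc|nx] := pselect (exists t, on_cycle x t); first exact: half.
  have [yc|ny] := pselect (exists t, on_cycle y t); first by apply/esym/half.
  by rewrite -((fP x).2 nx) fxy (fP y).2.
pose s := perm f_inj; pose S := [set x : 'I_m | `[< exists t, on_cycle x t >]].
(* A representative of [c] pulls back along [iota] to a cycle of [s] through [x], hence to a
   rotation of the orbit of [x]. *)
have cycleE x c t : c \in M -> t \in c -> iota x \in t -> perm_cycle s x = c.
  move=> cM tc xt; have [r [r0 /andP[_ ru] cE [rim _]]] := Mrep c cM.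
  have [p rp] : exists p, r = map iota p.
    elim: r rim {r0 ru cE} => [|v r IH] rim; first by exists [::].
    have [y <-] := rim v (mem_head _ _).
    have [p ->] := IH (fun w wr => rim w (mem_behead (s := v :: r) wr)).
    by exists (y :: p).
  have pu : uniq p by rewrite rp map_inj_uniq in ru.
  have rc : r \in c by rewrite cE rotclass_id.
  have sp : fcycle s p.
    rewrite -(eq_in_cycle (P := mem p) (e := frel (next p)))//.
      exact: cycle_next.
    move=> y z yp _ /=; rewrite permE; congr (_ == _); apply: iota_inj.
    by rewrite ((fP y).1 c r)// rp ?next_map// mem_map.
  have xp : x \in p.
    rewrite -(mem_map iota_inj) -rp; move: tc xt; rewrite {1}cE.
    by move=> /(mem_rotclass _ r0)[k ->]; rewrite mem_rot.
  have [i iE] := orbit_rot_cycle sp pu xp.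
  by rewrite /perm_cycle iE map_rot -rp rotclass_rot// cE.
exists (s, S).
  apply/andP; split=> /=.
    apply/fintype.subsetP => x; rewrite !inE permE => fx; apply: contrapT => nx.
    by case/eqP: fx; apply: (fP x).2.
  apply/forall_inP => x; rewrite inE => /asboolP[t [c cM [tc xt]]].
  have [r [r0 /andP[rc _] cE [_ re]]] := Mrep c cM.
  have xr : iota x \in r.
    by move: tc xt; rewrite cE => /(mem_rotclass _ r0)[k ->]; rewrite mem_rot.
  apply: re => //; rewrite permE ((fP x).1 c r)//.
    exact: next_cycle.
  by rewrite cE rotclass_id.
apply/fsetP => c; apply/imfsetP/idP => [[x /=]|cM].
  by rewrite inE => /asboolP[t [c' c'M [tc' xt]]] ->; rewrite (cycleE x c' t).
have [r [r0 _ cE [rim _]]] := Mrep c cM.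
have rc : r \in c by rewrite cE rotclass_id.
have [v vr] : exists v, v \in r by case: (r) r0 => // v r' _; exists v; rewrite mem_head.
have [x xv] := rim v vr; exists x; last by rewrite (cycleE x c r)// xv.
by rewrite inE; apply/asboolP; exists r, c => //; rewrite xv.
Qed.

(** Both sides are signed sums over the two ends of the bijection; the signs agree by
    [sign_perm_on]. *)
Lemma spec_coef_det (C : comNzRingType) :
  (spec_coef Phi n)%:~R =
  (\det (1%:M - 'X *: \matrix_(i, j) (e i j)%:R : 'M[{poly C}]_m))`_n.
Proof.
rewrite det_rel_coef /spec_coef.
have bij : set_bij [set` (fun x : 'S_m * {set 'I_m} => partial_perm e x && (#|x.2| == n))]
    [set M | multicycle Phi M /\ mc_length M = n]%classic perm_multicycle.
  split.
  - move=> [s S] /= /andP[px /eqP xn]; split; first exact: multicycle_perm_multicycle.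
    by rewrite mc_length_perm_multicycle//; case/andP: px.
  - move=> x y; rewrite !inE/= => /andP[px _] /andP[py _].
    by apply: perm_multicycle_inj.
  - move=> M /= [Mm Mn]; have [[s S] px xM] := perm_multicycle_surj Mm Mn.
    exists (s, S) => //=; apply/andP; split; first exact: px.
    by rewrite -Mn -xM mc_length_perm_multicycle ?eqxx//; case/andP: px.
rewrite (reindex_fsbig _ _ _ _ bij).
pose P := [pred x : 'S_m * {set 'I_m} | partial_perm e x && (#|x.2| == n)].
rewrite (_ : [set` _]%classic = [set` enum P]%classic); last first.
  by apply/seteqP; split=> x /=; rewrite mem_enum.
rewrite -fsbig_seq ?enum_uniq// big_enum/= raddf_sum.
apply: eq_bigr => -[s S] /andP[/andP[sS _] /eqP/= <-].
by rewrite card_perm_multicycle sign_perm_on// rmorphXn/= rmorphN1.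
Qed.

End Multicycles.

(** * Cycles of a labeled wedge *)

Section Wedge.
Variables (Phi : wedge) (p q : nat).
Hypothesis Phi_per : periodic_wedge Phi p q.

Let p_gt0 : (0 < p)%N. Proof. by case: Phi_per. Qed.

Lemma diag_LE i : (0 < i)%N -> Phi (i, i) = LE.
Proof.
case: Phi_per => _ _ EP i0; apply/EP; last by rewrite /eqpq eqxx.
by rewrite /inSigma /= i0 leqnn.
Qed.

Definition is_LN (l : label) := if l is LN then true else false.
Definition is_LS (l : label) := if l is LS then true else false.

Lemma LS_lt v : inSigma v -> Phi v = LS -> (v.1 < v.2)%N.
Proof.
case: v => i j /andP[/= i0 ij] ijS; rewrite ltn_neqAle ij andbT.
by apply/eqP => ij'; move: ijS; rewrite -ij' diag_LE.
Qed.

(* [v] is reached from the first column through N-vertices only. *)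
Definition good (v : vertex) : bool :=
  inSigma v && all (fun k => is_LN (Phi (v.1 - k.+1, v.2 - k.+1)%N)) (iota 0 v.1.-1).

Lemma good_inSigma v : good v -> inSigma v. Proof. by case/andP. Qed.

Lemma good_first j : (0 < j)%N -> good (1%N, j).
Proof. by move=> j0; rewrite /good /inSigma/= j0. Qed.

Lemma good_LN v : good v -> Phi v = LN -> good (v.1.+1, v.2.+1).
Proof.
case: v => i j /andP[/andP[/= i0 ij] /allP vN] ijN; rewrite /good /inSigma/= ltnS ij/=.
apply/allP => -[|k]; first by rewrite !subSS !subn0 ijN.
by rewrite !subSS mem_iota add0n => /andP[_ ki]; apply: vN; rewrite mem_iota/= -ltnS prednK.
Qed.

(** The vertex [p] steps back on the diagonal is still beyond column [q], so it is equivalent to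
    [v], and goodness labels it N. *)
Lemma good_high v : good v -> (q + p < v.1)%N -> Phi v = LN.
Proof.
case: v => i j /andP[ijS /allP/= vN] qpi; have /andP[/= i0 ij] := ijS.
case: Phi_per => _ Phi_eq _.
have pi : (p < i)%N by rewrite (leq_ltn_trans _ qpi)// leq_addl.
have pj : (p < j)%N by rewrite (leq_trans pi).
suff <- : Phi (i - p, j - p)%N = Phi (i, j).
  have := vN p.-1; rewrite prednK// mem_iota add0n/= -ltnS !prednK// => /(_ pi).
  by case: (Phi _).
have qi : (q < i - p)%N by rewrite ltn_subRL addnC.
apply: Phi_eq => //; first by rewrite /inSigma/= subn_gt0 pi leq_sub2r.
have shift x : (q < x - p)%N -> (p < x)%N -> eqpq p q (x - p) x.
  move=> qx px; rewrite /eqpq (minn_idPl (leq_subr _ _)) qx/=.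
  by rewrite -(modnDr (x - p)) (subnK (ltnW px)) eqxx orbT.
by rewrite /veq/= !shift// (leq_trans qi)// leq_sub2r.
Qed.

Lemma out_edges_inSigma v x : inSigma v -> x \in out_edges Phi v -> inSigma x.
Proof.
case: v => i j /andP[/= i0 ij]; rewrite /out_edges; case: (Phi _) => //=.
  by rewrite inE => /eqP ->; rewrite /inSigma/= ltnS.
by rewrite !inE => /orP[] /eqP ->.
Qed.

Lemma good_out_edges v x : good v -> x \in out_edges Phi v -> good x.
Proof.
move=> gv; have := good_LN gv; rewrite /out_edges; case: (Phi _) => //= gN.
  by rewrite inE => /eqP ->; apply: gN.
by move: gN => _; rewrite !inE => /orP[] /eqP ->; apply: good_first.
Qed.

Lemma out_edges_height v x : inSigma v -> x \in out_edges Phi v -> (x.2 <= v.2.+1)%N.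
Proof.
case: v => i j /andP[/= i0 ij]; rewrite /out_edges; case: (Phi _) => //=.
  by rewrite inE => /eqP ->.
by rewrite !inE => /orP[] /eqP ->.
Qed.

(** The two edges of an S-vertex could coincide only on the diagonal, where every label is E. *)
Lemma out_edges_uniq v : inSigma v -> uniq (out_edges Phi v).
Proof.
move=> vS; have := LS_lt vS; rewrite /out_edges; case: (Phi _) => //= /(_ erefl) v12.
by rewrite inE xpair_eqE/= eqSS ltn_eqF.
Qed.

(** * Location of a simple cycle in terms of its length *)

Section Cycle.
Variable s : seq vertex.
Hypothesis s_cycle : ucycle (edge Phi) s.

Lemma cycle_pred w : w \in s -> exists2 v, v \in s & edge Phi v w.
Proof.
case/andP: s_cycle => sc _ ws; exists (prev s w); rewrite ?mem_prev//.
exact: prev_cycle.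
Qed.

Lemma cycle_inSigma v : v \in s -> inSigma v.
Proof. by case/andP: s_cycle => sc _ /(next_cycle sc)/andP[]. Qed.

(** S-edges end in the first column, so a cycle enters any later column from the N-vertex diagonally
    below. *)
Lemma cycle_run i j k : (i, j) \in s -> (k < i)%N ->
  (i - k, j - k)%N \in s /\ (forall l, (l < k)%N -> Phi (i - l.+1, j - l.+1)%N = LN).
Proof.
move=> ijs; elim: k => [|k IH] ki; first by rewrite !subn0.
have [ks kN] := IH (ltnW ki).
have ik : (1 < i - k)%N by rewrite ltn_subRL addn1.
have [v vs /andP[vS]] := cycle_pred ks; rewrite /out_edges.
case vE: (Phi v) => //=; last first.
  by rewrite !inE !xpair_eqE => /orP[] /andP[/eqP i1]; rewrite i1 in ik.
rewrite inE xpair_eqE => /andP[/eqP iv /eqP jv].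
have {}vE : Phi (i - k.+1, j - k.+1)%N = LN.
  by rewrite !subnS iv jv /= -vE; case: (v).
split; first by rewrite !subnS iv jv; case: (v) vs.
by move=> l; rewrite ltnS leq_eqVlt => /orP[/eqP ->//|/kN].
Qed.

Lemma cycle_good v : v \in s -> good v.
Proof.
case: v => i j vs; rewrite /good cycle_inSigma//=; apply/allP => k.
rewrite mem_iota add0n => /andP[_ ki].
have i0 : (0 < i)%N by case: (i) ki.
have ii : (i.-1 < i)%N by rewrite prednK.
by have [_ ->] := cycle_run vs ii.
Qed.

(** The diagonal run back to the first column consists of [v.1] distinct vertices of the cycle. *)
Lemma cycle_column v : v \in s -> (v.1 <= size s)%N.
Proof.
case: v => i j vs /=.
pose run := [seq (i - k, j - k)%N | k <- iota 0 i].
have <- : size run = i by rewrite size_map size_iota.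
apply: uniq_leq_size => [|_ /mapP[k + ->]]; last first.
  by rewrite mem_iota add0n => /andP[_ ki]; have [] := cycle_run vs ki.
rewrite map_inj_in_uniq ?iota_uniq// => k l; rewrite !mem_iota !add0n => /andP[_ ki] /andP[_ li].
by case=> kl _; rewrite -(subKn (ltnW ki)) kl subKn// ltnW.
Qed.

(** A backward S-edge lands at height at most [(size s).+1] by [cycle_column], and every other edge
    climbs by exactly one. So all heights from [(size s).+1] to [v.2] occur on the cycle, and there
    are at most [size s] of them. *)
Lemma cycle_height v : v \in s -> (v.2 <= (size s).*2)%N.
Proof.
case: v => i j vs /=; rewrite -addnn -leq_subLR.
have descent k : (k < j - size s)%N -> exists i', (i', j - k)%N \in s.
  elim: k => [|k IH] kj; first by exists i; rewrite subn0.
  have [i' i's] := IH (ltnW kj).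
  have jk : ((size s).+1 < j - k)%N by rewrite ltn_subRL addnC addSnnS -ltn_subRL.
  have [w ws /andP[wS]] := cycle_pred i's; rewrite /out_edges.
  case: (Phi w) => //=.
    by rewrite inE xpair_eqE => /andP[_ /eqP jw]; exists w.1; rewrite subnS jw; case: (w) ws.
  rewrite !inE !xpair_eqE => /orP[] /andP[_ /eqP jw].
    by have := cycle_column ws; rewrite leqNgt -ltnS -jw jk.
  by exists w.1; rewrite subnS jw; case: (w) ws.
pose run := [seq (j - k)%N | k <- iota 0 (j - size s)].
have <- : size run = (j - size s)%N by rewrite size_map size_iota.
rewrite -(size_map snd s); apply: uniq_leq_size => [|_ /mapP[k + ->]]; last first.
  rewrite mem_iota add0n => /andP[_ kj]; have [i' i's] := descent k kj.
  by apply/mapP; exists (i', j - k)%N.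
rewrite map_inj_in_uniq ?iota_uniq// => k l; rewrite !mem_iota !add0n => /andP[_ ki] /andP[_ li].
have le x : (x < j - size s -> x <= j)%N by move=> /ltnW/leq_trans; apply; apply: leq_subr.
by move=> kl; rewrite -(subKn (le k ki)) kl subKn// le.
Qed.

End Cycle.

(** * Residues of indices *)

Definition res_nat (x : nat) : nat := if (x < q)%N then x else (q + (x - q) %% p)%N.

Lemma res_nat_lt x : (res_nat x < q + p)%N.
Proof.
rewrite /res_nat; case: ifP => [xq|_]; first by rewrite (leq_trans xq)// leq_addr.
by rewrite ltn_add2l ltn_mod.
Qed.

(** Zero-based, as in [cls]: [x] stands for the index [x.+1], so the preperiod is [x < q]. *)
Definition res (x : nat) : 'I_(q + p) := Ordinal (res_nat_lt x).

Lemma res_id x : (x < q + p)%N -> res x = x :> nat.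
Proof.
rewrite /= /res_nat; case: (ltnP x q) => // qx xqp.
by rewrite modn_small ?subnKC// ltn_subLR.
Qed.

Lemma res_eqpq x : eqpq p q x.+1 (res x).+1.
Proof.
rewrite /eqpq /= /res_nat; case: ltnP => qx; first by rewrite eqxx.
apply/orP; right; rewrite leq_min !ltnS qx leq_addr/=.
by rewrite -addSn modnDmr addSn subnKC.
Qed.

Lemma eqpq_res x y : eqpq p q x.+1 y.+1 = (res x == res y).
Proof.
rewrite -val_eqE /= /res_nat /eqpq leq_min !ltnS eqSS.
have [xq|qx] := ltnP x q; have [yq|qy] := ltnP y q.
- by rewrite orbF.
- by rewrite /= orbF ltn_eqF ?[RHS]ltn_eqF// ?(leq_trans xq)// leq_addr.
- by rewrite /= orbF gtn_eqF ?[RHS]gtn_eqF// ?(leq_trans yq)// leq_addr.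
rewrite /= eqn_add2l -(eqn_modDl q.+1 (x - q)) !addSn !subnKC//.
by case: eqP => [->|]; rewrite ?eqxx.
Qed.

End Wedge.

(** * The ordered cover *)

Section Covering.
Variables (Phi : wedge) (p q : nat).
Hypothesis Phi_per : periodic_wedge Phi p q.
Local Notation res := (res Phi_per).
Local Notation V := ('I_(q + p) * 'I_(q + p))%type.

(* [V] is the two-fold ordered cover of the quotient graph: ordered pairs of
   residues, labelled through the corresponding unordered pair. *)
Definition label2 (u : V) : label := Phi ((minn u.1 u.2).+1, (maxn u.1 u.2).+1).

Definition out2 (u : V) : seq V :=
  match label2 u with
  | LN => [:: (res u.1.+1, res u.2.+1)]
  | LS => [:: (res 0, res u.1.+1); (res 0, res u.2.+1)]
  | LE => [::]
  end.

Definition fwd2 (u : V) : seq V :=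
  match label2 u with
  | LN => [:: (res u.1.+1, res u.2.+1)]
  | LS => [:: (res 0, res u.2.+1)]
  | LE => [::]
  end.

Definition res2 (v : vertex) : V := (res v.1.-1, res v.2.-1).

Lemma res_resS x : res (res x).+1 = res x.+1.
Proof.
apply/eqP; rewrite -eqpq_res /eqpq.
have := res_eqpq Phi_per x; rewrite /eqpq => /orP[/eqP <-|/andP[]]; first by rewrite eqxx.
rewrite !leq_min => /andP[qx qr] /eqP xr; apply/orP; right; rewrite (leqW qx) (leqW qr)/=.
by rewrite -[(res x).+2]addn1 -[x.+2]addn1 -modnDml -xr modnDml.
Qed.

(** Reduction may reverse the order of the coordinates; the crossed clause of [veq] covers that
    case. *)
Lemma label2E v : inSigma v -> label2 (res2 v) = Phi v.
Proof.
case: v => -[|i] [|j] /andP[//= _ ij]; rewrite /label2/=.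
have ri := res_eqpq Phi_per i; have rj := res_eqpq Phi_per j.
case: Phi_per => _ Phi_eq _; apply/esym/Phi_eq => //.
  by rewrite /inSigma/= ltnS (leq_trans (geq_minl _ _) (leq_maxl _ _)).
rewrite /veq; case: (leqP (res i) (res j)) => _ /=; first by rewrite ri rj.
by rewrite ri rj orbT.
Qed.

(** The covering property: [res2] matches the out-edges of a vertex with those of its image,
    multiplicities included. *)
Lemma map_res2_out_edges v : inSigma v ->
  map res2 (out_edges Phi v) = out2 (res2 v).
Proof.
move=> vS; rewrite /out_edges /out2 label2E//.
case: v vS => -[|i] [|j] /andP[//= _ ij].
by case: (Phi _) => //=; rewrite /res2/= !res_resS.
Qed.

(** * Coordinate swap and comparison with the finite model *)

Definition swap (u : V) : V := (u.2, u.1).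
Definition sort2 (u : V) : V := if (u.1 <= u.2)%N then u else swap u.

Lemma sort2_le u : ((sort2 u).1 <= (sort2 u).2)%N.
Proof. by rewrite /sort2; case: (leqP u.1 u.2) => //= /ltnW. Qed.

Definition to_cls (u : V) : cls p q := exist _ (sort2 u) (sort2_le u).

Lemma to_cls_val (w : cls p q) : to_cls (val w) = w.
Proof. by apply/val_inj; rewrite /= /sort2 (valP w). Qed.

Lemma to_cls_swap u : to_cls (swap u) = to_cls u.
Proof.
apply/val_inj; rewrite /= /sort2 /swap/=; case: u => a b /=.
by case: ltngtP => // /val_inj ->.
Qed.

(** Swapping a pair swaps the target of its N-edge, but only exchanges its two S-edges. *)
Lemma sum_out2_swap (C : nmodType) (y : V -> C) u :
  (forall u, y (swap u) = y u) ->
  \sum_(v <- out2 (swap u)) y v = \sum_(v <- out2 u) y v.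
Proof.
move=> yS; rewrite /out2 /label2/= minnC maxnC; case: (Phi _) => //.
  by rewrite !big_seq1 -yS.
by rewrite !big_cons !big_nil !addr0 addrC.
Qed.

Lemma res2_cls_rep (w : cls p q) : res2 (cls_rep w) = val w.
Proof.
case: w => -[a b] /= ab; rewrite /res2/=; congr pair; apply/val_inj;
exact: res_id.
Qed.

Lemma cls_rep_inSigma (w : cls p q) : inSigma (cls_rep w).
Proof. by rewrite /inSigma/= ltnS (valP w). Qed.

Lemma veq_cls_rep x (w : cls p q) : inSigma x ->
  veq p q x (cls_rep w) = (to_cls (res2 x) == w).
Proof.
case: x => -[|i] [|j] // _; rewrite /veq/= !(eqpq_res Phi_per).
have rv (a : 'I_(q + p)) : res a = a by apply/val_inj; exact: res_id.
rewrite !rv -[RHS]val_eqE -[X in _ = (X == _)]/(sort2 (res i, res j)).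
move: (res i) (res j) => {}i {}j; case: w => -[a b] /= ab; rewrite /sort2 /swap/=.
case: (leqP i j) => ij; rewrite !xpair_eqE/=.
  apply/orP/idP => [[//|/andP[/eqP ia /eqP jb]]|->]; last by left.
  move: ij; rewrite ia jb => ba.
  have -> : a = b by apply/val_inj/eqP; rewrite eqn_leq ab ba.
  by rewrite eqxx.
rewrite [X in _ = X]andbC; apply/orP/idP => [[/andP[/eqP ia /eqP jb]|//]|->]; last by right.
by move: ij; rewrite ia jb ltnNge ab.
Qed.

Lemma sum_qcount (C : pzSemiRingType) (x : cls p q -> C) v :
  \sum_w (qcount Phi v w)%:R * x w = \sum_(u <- out2 (val v)) x (to_cls u).
Proof.
rewrite -res2_cls_rep -map_res2_out_edges ?cls_rep_inSigma// big_map.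
rewrite -(big_map (fun x => to_cls (res2 x)) xpredT x) -[RHS]sum_count_mem.
apply: eq_bigr => w _; congr (_%:R * _); rewrite /qcount count_map.
apply: eq_in_count => u /(out_edges_inSigma (cls_rep_inSigma v)) uS.
by rewrite veq_cls_rep.
Qed.

(** Solutions on the quotient lift to symmetric solutions on the ordered cover. Conversely every
    solution upstairs is symmetric when [|t| < 1], so it descends. *)
Lemma PGamma1_eq0 (R : realType) (t : R[i]) : `|t| < 1 ->
  (PGamma1 Phi p q t == 0) =
  (\det (1%:M - t *: enum_mx (fun u v => (count_mem v (out2 u))%:R)) == 0).
Proof.
move=> t1; rewrite /PGamma1.
have -> : Defs.adj1 R Phi p q = enum_mx (fun v w => (qcount Phi v w)%:R) by [].
apply/det_enum_mx_eq0P/det_enum_mx_eq0P => -[x [v xv] xE].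
  exists (fun u => x (to_cls u)); first by exists (val v); rewrite to_cls_val.
  move=> u; rewrite sum_count_mem xE sum_qcount/= /sort2; case: leqP => // _.
  by rewrite (sum_out2_swap (y := fun u => x (to_cls u)))// => w; rewrite to_cls_swap.
have xS u : x (swap u) = x u.
  pose g u := x u - x (swap u).
  (* The S-edges of [u] and [swap u] have the same targets and cancel in [g]; what remains has
     out-degree at most 1 and admits no nonzero solution. *)
  pose L (u : V) := if label2 u is LN then [:: (res u.1.+1, res u.2.+1)] else [::].
  suff : g u = 0 by move/eqP; rewrite subr_eq0 => /eqP.
  apply/eqP; apply: contraT => gu.
  have L1 w : (size (L w) <= 1)%N by rewrite /L; case: (label2 _).
  case: (negP (det_out_le1_neq0 L1 t1)).
  apply/det_enum_mx_eq0P; exists g; first by exists u.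
  move=> w; rewrite sum_count_mem /g xE (xE (swap w)) !sum_count_mem -mulrBr; congr (_ * _).
  rewrite /out2 /L /label2/= minnC maxnC; case: (Phi _) => /=.
  - by rewrite !big_seq1.
  - by rewrite !big_cons !big_nil !addr0 [X in _ - X]addrC subrr.
  - by rewrite !big_nil subrr.
exists (fun w => x (val w)).
  by exists (to_cls v); rewrite /= /sort2; case: leqP => // _; rewrite xS.
move=> w; rewrite sum_qcount xE sum_count_mem; congr (_ * _).
by apply: eq_bigr => u _; rewrite /= /sort2; case: leqP => // _; rewrite xS.
Qed.

(** * The finite grid glued to the ordered cover *)

Section Truncation.
Variables (C : fieldType) (N n : nat).
(** Backward edges from the cover land at height at most [(q + p).+1], so at least [n] levels remain
    below height [N]. *)
Hypothesis N_large : (n + (q + p).+2 <= N)%N.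
Local Notation T := ('I_N * 'I_N)%type.
Local Notation poly_mx f := (enum_mx (fun x y => (f x y)%:R : {poly C})).

Definition vtx (w : T) : vertex := (w.1 : nat, w.2 : nat).
Definition in_grid (x : vertex) := (x.1 < N)%N && (x.2 < N)%N.
Definition cover_mx : 'M[{poly C}]_#|{: V}| := poly_mx (fun u u' => count_mem u' (out2 u)).
Definition fwd_mx : 'M[{poly C}]_#|{: V}| := poly_mx (fun u u' => count_mem u' (fwd2 u)).
(** The residue [u.1] stands for the index [u.1.+1], whose backward edge goes to height [u.1.+2]. *)
Definition back (u : V) : seq vertex := if is_LS (label2 u) then [:: (1%N, u.1.+2)] else [::].
Definition back_mx : 'M[{poly C}]_(#|{: V}|, #|{: T}|) :=
  poly_mx (fun u w => count_mem (vtx w) (back u)).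
(** Grid points that are not good, including those outside Sigma, lie on no cycle of the wedge and
    get no edge inside the grid. *)
Definition good_out (v : vertex) : seq vertex := if good Phi v then out_edges Phi v else [::].
(** Edges leaving the grid are redirected to residues. A point that is not good sends all edges of
    its image upwards, so that the projection stays a covering at every grid point. *)
Definition exits (v : vertex) : seq V :=
  if good Phi v then map res2 [seq x <- out_edges Phi v | ~~ in_grid x] else out2 (res2 v).
Definition grid_mx : 'M[{poly C}]_#|{: T}| :=
  poly_mx (fun v w => count_mem (vtx w) (good_out (vtx v))).
Definition exit_mx : 'M[{poly C}]_(#|{: T}|, #|{: V}|) :=
  poly_mx (fun v u => count_mem u (exits (vtx v))).
Definition proj_mx : 'M[{poly C}]_(#|{: T}|, #|{: V}|) :=
  poly_mx (fun v u => nat_of_bool (res2 (vtx v) == u)).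

Lemma sum_count_vtx (s : seq vertex) (f : vertex -> {poly C}) :
  \sum_(w : T) (count_mem (vtx w) s)%:R * f (vtx w) = \sum_(x <- s | in_grid x) f x.
Proof.
elim: s => [|x s IH]; first by rewrite big_nil big1// => w _; rewrite mul0r.
rewrite big_cons -IH.
transitivity (\sum_w ((x == vtx w)%:R * f (vtx w) + (count_mem (vtx w) s)%:R * f (vtx w))).
  by apply: eq_bigr => w _; rewrite /= natrD mulrDl.
rewrite big_split/=; case: ifPn => [/andP[x1 x2]|xN].
  congr (_ + _); pose w0 : T := (Ordinal x1, Ordinal x2).
  have xw : x = vtx w0 by exact: surjective_pairing.
  rewrite (bigD1 w0)//= -xw eqxx mul1r big1 ?addr0// => w wu.
  suff -> : (x == vtx w) = false by rewrite mul0r.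
  apply: contraNF wu; rewrite xw => /eqP[e1 e2].
  by apply/eqP; case: (w) e1 e2 => a b /= e1 e2; congr pair; apply/val_inj.
rewrite big1 ?add0r// => w _; case: eqP => [xw|_]; last by rewrite mul0r.
by move: xN; rewrite /in_grid xw/= !ltn_ord.
Qed.

Lemma fwd_back_cover : fwd_mx + back_mx *m proj_mx = cover_mx.
Proof.
rewrite mul_enum_mx; apply/matrixP => i j; rewrite !mxE.
rewrite (sum_count_vtx _ (fun x => (res2 x == enum_val j)%:R)).
rewrite /back /fwd2 /out2; case: (label2 _) => /=; rewrite ?big_nil ?addr0//.
rewrite big_cons big_nil addr0 !addn0 natrD addrC; congr (_ + _).
suff -> : in_grid (1%N, (enum_val i).1.+2) by rewrite /res2/=.
have uN : ((enum_val i).1.+2 < N)%N.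
  by rewrite (leq_trans _ N_large)// (leq_trans _ (leq_addl _ _))// !ltnS ltn_ord.
by rewrite /in_grid/= uN (leq_trans _ uN).
Qed.

(** Each edge upstairs either stays in the grid or exits, and its projection is the same in both
    cases. With [fwd_back_cover] this feeds [det_block_quotient]. *)
Lemma exit_grid_proj : exit_mx + grid_mx *m proj_mx = proj_mx *m cover_mx.
Proof.
rewrite !mul_enum_mx; apply/matrixP => i j; rewrite !mxE.
set v := enum_val i; set u := enum_val j.
rewrite (sum_count_vtx _ (fun x => (res2 x == u)%:R)).
rewrite (bigD1 (res2 (vtx v)))//= eqxx mul1r [X in _ = _ + X]big1 ?addr0; last first.
  by move=> w /negPf wv; rewrite eq_sym wv mul0r.
rewrite /exits /good_out; case: ifPn => gv; last by rewrite big_nil addr0.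
rewrite -(map_res2_out_edges (good_inSigma gv)).
elim: (out_edges _ _) => [|x s IH]; first by rewrite big_nil addr0.
rewrite big_cons/=; case: (in_grid x) => /=; last by rewrite !natrD -IH addrA.
by rewrite [in RHS]natrD -IH addrCA.
Qed.

Definition fwd_edges (v : vertex) : seq vertex :=
  match Phi v with
  | LN => [:: (v.1.+1, v.2.+1)]
  | LS => [:: (1%N, v.2.+1)]
  | LE => [::]
  end.

Lemma fwd_edges_height v x : x \in fwd_edges v ->
  x \in out_edges Phi v /\ x.2 = v.2.+1.
Proof.
rewrite /fwd_edges /out_edges; case: (Phi v) => //; rewrite !inE => /eqP ->.
  by rewrite eqxx.
by rewrite eqxx orbT.
Qed.

(* A good S-vertex lies in the first [q + p] columns, where residues are exact. *)
Lemma count_out_edges v x : good Phi v ->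
  count_mem x (out_edges Phi v) =
  (count_mem x (back (res2 v)) + count_mem x (fwd_edges v))%N.
Proof.
move=> gv; have vS := good_inSigma gv.
rewrite /back label2E// /out_edges /fwd_edges; case vE: (Phi v) => //.
have vK : (v.1 <= q + p)%N.
  by rewrite leqNgt; apply/negP => /(good_high Phi_per gv); rewrite vE.
have -> : (res2 v).1.+2 = v.1.+1.
  case: (v) vS vK => -[|i] j /andP[//= _ _] iK.
  by rewrite -[res_nat p q i]/(nat_of_ord (res i)) res_id.
by rewrite /= !addn0.
Qed.

(** At good vertices the subtracted term cancels the backward S-edges, and the remaining edges
    climb. At other vertices only the subtracted term is left, and it leads to good vertices; hence
    the key 0 there. *)
Lemma det_forward_part :
  \det (1%:M - 'X *: (grid_mx - proj_mx *m back_mx)) = 1.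
Proof.
pose key (i : 'I_#|{: T}|) :=
  let v := vtx (enum_val i) in if good Phi v then v.2.+1 else 0%N.
apply: (det_strictly_increasing (key := key)) => i j.
rewrite mul_enum_mx !mxE; set v := enum_val i; set w := enum_val j.
rewrite (bigD1 (res2 (vtx v)))//= [X in _ - (_ + X)]big1 ?addr0; last first.
  by move=> u /negPf uv; rewrite eq_sym uv mul0r.
rewrite eqxx mul1r /key -/v -/w /good_out.
case: ifPn => gv.
  rewrite count_out_edges// natrD addrC addKr => xw.
  have : vtx w \in fwd_edges (vtx v).
    by apply: contraNT xw => /count_memPn ->; rewrite mulr0.
  by move=> /fwd_edges_height[/(good_out_edges gv) -> ->]; rewrite !ltnS.
rewrite sub0r => xw.
have : vtx w \in back (res2 (vtx v)).
  by apply: contraNT xw => /count_memPn ->; rewrite oppr0 mulr0.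
rewrite /back; case: ifP => // _; rewrite inE => /eqP ->.
by rewrite good_first.
Qed.

(** The glued graph has the determinant of the ordered cover. In it, a cycle using both parts falls
    low into the grid and must climb out again, which takes at least [n] edges. *)
Lemma det_grid_fwd_cover :
  ('X^n %| \det (1%:M - 'X *: fwd_mx) * \det (1%:M - 'X *: grid_mx)
           - \det (1%:M - 'X *: cover_mx))%R.
Proof.
have := det_block_quotient 'X fwd_back_cover exit_grid_proj.
rewrite det_forward_part mulr1 => <-.
rewrite scale_block_mx (@scalar_mx_block _ #|{: V}| #|{: T}|) opp_block_mx add_block_mx !add0r.
(* A lower bound for the number of edges needed to leave the grid from a good vertex. *)
pose h (i : 'I_#|{: T}|) :=
  let v := vtx (enum_val i) in if good Phi v then (N - v.2)%N else 0%N.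
rewrite -opprB dvdpNr; apply: (det_block_eqmod (h := h)) => i j.
- rewrite !mxE dvdpNr /h; set v := vtx _; case: ifPn => gv; last by rewrite expr0 dvd1p.
  have [|xv] := boolP (has (fun x => ~~ in_grid x) (out_edges Phi v)); last first.
    rewrite /exits gv (_ : [seq x <- _ | _] = [::]) ?mulr0 ?dvdp0//.
    by apply/eqP; rewrite -[_ == _]negbK -has_filter.
  case/hasP => x xv xN; have xS := out_edges_inSigma (good_inSigma gv) xv.
  (* An edge climbs by at most one, so an exit starts at height at least [N - 1]; the factor ['X] of
     the edge pays for it. *)
  apply: dvdp_mulr; rewrite -['X in X in _ %| X]expr1 dvdp_exp2l// leq_subLR addn1.
  apply: leq_trans (out_edges_height (good_inSigma gv) xv).
  apply: contraNT xN; rewrite -ltnNge /in_grid => xN; rewrite xN andbT.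
  by rewrite (leq_ltn_trans _ xN)//; case/andP: xS.
- rewrite !mxE mulrBl dvdp_sub//.
    by case: eqP => [->|_]; rewrite ?mul1r ?dvdpp// mul0r dvdp0.
  rewrite /h; set v := vtx _; set w := vtx _; rewrite /good_out.
  case: ifPn => gv; last by rewrite mulr0 mul0r dvdp0.
  have [wv|/count_memPn ->] := boolP (w \in out_edges Phi v); last by rewrite mulr0 mul0r dvdp0.
  (* Along an edge [h] drops by at most one, which its factor ['X] compensates. *)
  rewrite (good_out_edges gv wv) mulrAC; apply: dvdp_mulr.
  rewrite -exprS dvdp_exp2l// leq_subLR addnS -addSn.
  have wN : (w.2 <= N)%N by apply: ltnW; apply: ltn_ord.
  by rewrite -{1}(subnKC wN) leq_add2r (out_edges_height (good_inSigma gv) wv).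
- rewrite !mxE mulNr dvdpNr /h; set u := enum_val i; set w := vtx _.
  have [wu|/count_memPn ->] := boolP (w \in back u); last by rewrite mulr0 mul0r dvdp0.
  have wE : w = (1%N, u.1.+2) by move: wu; rewrite /back; case: ifP => // _; rewrite inE => /eqP.
  rewrite wE good_first//= mulrAC; apply: dvdp_mulr; apply: dvdp_mull.
  rewrite dvdp_exp2l// leq_subRL.
    rewrite addnC (leq_trans _ N_large)// leq_add2l !ltnS; exact/ltnW/ltn_ord.
  have wN : (w.2 < N)%N by apply: ltn_ord.
  by rewrite wE in wN; apply: ltnW.
Qed.

(** Cycles of length at most [k] have height at most [k.*2] and pass only through good vertices, so
    the grid sees them all. *)
Lemma spec_coef_grid k : (k.*2 < N)%N ->
  (spec_coef Phi k)%:~R = (\det (1%:M - 'X *: grid_mx))`_k.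
Proof.
move=> kN; pose iota (i : 'I_#|{: T}|) := vtx (enum_val i).
pose e (i j : 'I_#|{: T}|) := good Phi (iota i) && edge Phi (iota i) (iota j).
have -> : grid_mx = \matrix_(i, j) (e i j)%:R.
  apply/matrixP => i j; rewrite !mxE /e /good_out -/(iota i) -/(iota j).
  have [gi|//] := boolP (good Phi (iota i)).
  by rewrite count_uniq_mem ?(out_edges_uniq Phi_per) ?(good_inSigma gi)// /edge (good_inSigma gi).
apply: (spec_coef_det (iota := iota)) => [i j [ij1 ij2]|i j /andP[]//|s s0 sc sk].
  apply/enum_val_inj; case: (enum_val i) (enum_val j) ij1 ij2 => a b [c d] /=.
  by move=> /val_inj -> /val_inj ->.
split=> [v vs|x y xs xy]; last by rewrite /e (cycle_good sc xs).
have v2 : (v.2 < N)%N.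
  by rewrite (leq_ltn_trans (cycle_height sc vs))// (leq_ltn_trans _ kN)// leq_double.
have v1 : (v.1 < N)%N.
  by rewrite (leq_ltn_trans _ v2)//; case/andP: (cycle_inSigma sc vs).
exists (enum_rank (Ordinal v1, Ordinal v2)); rewrite /iota enum_rankK.
exact/esym/surjective_pairing.
Qed.

End Truncation.
End Covering.

(** * Power series with a polynomial multiple *)

Local Open Scope classical_set_scope.

Lemma complex_exp_lt (R : realType) (c e : R[i]) : `|c| < 1 -> 0 < e ->
  exists N, forall n, (N <= n)%N -> `|c| ^+ n < e.
Proof.
have [r r0 rE] : exists2 r : R, 0 <= r & `|c| = r%:C.
  exists (complex.Re `|c|); last by rewrite RRe_real// normr_real.
  by rewrite -lecR RRe_real ?normr_real// normr_ge0.
move=> c1 e0; have eE : (complex.Re e)%:C = e by rewrite RRe_real// gtr0_real.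
have r1 : `|r| < 1 by rewrite ger0_norm// -ltcR -rE.
have er0 : 0 < complex.Re e by rewrite -ltcR eE.
have /cvgrPdist_lt/(_ _ er0)[N _ HN] := cvg_expr r1.
exists N => n /HN /=; rewrite sub0r normrN ger0_norm ?exprn_ge0// => rn.
by rewrite rE -rmorphXn/= -eE ltcR.
Qed.

(** The limit is the fixed point of [l = D + c * l]. Once [d] is within [e / 2 * (1 - |c|)] of [D],
    after [k] further steps the error is at most [|c| ^+ k * E + e / 2]. *)
Lemma cvg_affine_contraction (R : realType) (c D : R[i]) (u d : nat -> R[i]^o) :
  `|c| < 1 -> (forall n, u n.+1 = d n.+1 + c * u n) ->
  d @ \oo --> (D : R[i]^o) -> u @ \oo --> (D / (1 - c) : R[i]^o).
Proof.
move=> c1 uS dD; apply/cvgrPdist_lt => e e0.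
have c10 : 0 < 1 - `|c| by rewrite subr_gt0.
have c1N : 1 - c != 0.
  by apply: contraTneq c1 => /eqP; rewrite subr_eq0 => /eqP <-; rewrite normr1 ltxx.
set l := D / (1 - c).
have lE : l = D + c * l.
  by apply/eqP; rewrite -subr_eq -{1}[l]mul1r -mulrBl mulrC divfK.
have e20 : 0 < e / 2 by rewrite divr_gt0.
have e'0 : 0 < (e / 2) * (1 - `|c|) by rewrite mulr_gt0.
have /cvgrPdist_lt/(_ _ e'0)[N _ HN] := dD.
pose E := `|l - u N| + 1.
have E0 : 0 < E by rewrite ltr_wpDl.
have bound k : `|l - u (N + k)%N| <= `|c| ^+ k * E + e / 2.
  elim: k => [|k IH].
    by rewrite addn0 expr0 mul1r /E -addrA lerDl addr_ge0// ltW.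
  rewrite addnS uS {1}lE opprD addrACA -mulrBr.
  apply: (le_trans (ler_normD _ _)).
  have /ltW dk := HN (N + k).+1 (leq_trans (leq_addr k N) (leqnSn _)).
  apply: (le_trans (lerD dk (_ : _ <= `|c| * (`|c| ^+ k * E + e / 2)))).
    by rewrite normrM ler_wpM2l.
  rewrite mulrBr mulr1 (mulrC (e / 2) `|c|) [_ * (_ + _)]mulrDr mulrA -exprS.
  by rewrite addrCA subrK.
have [M HM] := complex_exp_lt c1 (divr_gt0 e20 E0).
exists (N + M)%N => // n /= Nn.
have Nn' : (N <= n)%N by rewrite (leq_trans _ Nn)// leq_addr.
rewrite -(subnKC Nn'); apply: (le_lt_trans (bound _)).
rewrite [X in _ < X](splitr e) ltrD2r -ltr_pdivlMr// HM//.
by rewrite leq_subRL.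
Qed.

(** Linear factors are divided out one at a time. If [b] is the product of ['X - z] and [a'], the
    partial sums satisfy [A'_{n+1} = (t / z) A'_n - B_{n+1} / z], a contraction because
    [|t| < 1 <= |z|]. *)
Lemma cvg_series_poly_quotient (R : realType) (rs : seq R[i]) (t B : R[i])
    (a b : nat -> R[i]) :
  `|t| < 1 -> (forall z, z \in rs -> 1 <= `|z|) ->
  (forall n, \sum_(k < n.+1) a k * (\prod_(z <- rs) ('X - z%:P))`_(n - k) = b n) ->
  series (fun n => (b n * t ^+ n : R[i]^o)) @ \oo --> (B : R[i]^o) ->
  series (fun n => (a n * t ^+ n : R[i]^o)) @ \oo -->
    (B / (\prod_(z <- rs) ('X - z%:P)).[t] : R[i]^o).
Proof.
move=> t1; elim: rs a b B => [|z rs IH] a b B rs1 ab bB.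
  rewrite big_nil hornerC divr1 (_ : a = b)//; apply/funext => n.
  rewrite -ab big_nil big_ord_recr/= subnn coef1 mulr1 big1 ?add0r// => i _.
  by rewrite coef1 subn_eq0 leqNgt ltn_ord mulr0.
have z1 : 1 <= `|z| by rewrite rs1// mem_head.
have z0 : z != 0 by rewrite -normr_gt0 (lt_le_trans ltr01).
pose P := \prod_(z <- rs) ('X - z%:P).
pose a' n := \sum_(k < n.+1) a k * P`_(n - k).
have a'b n : b n = (if n is m.+1 then a' m else 0) - z * a' n.
  rewrite -ab big_cons -/P /a'.
  transitivity (\sum_(k < n.+1) (a k * (P * 'X)`_(n - k) - z * (a k * P`_(n - k)))).
    apply: eq_bigr => k _; rewrite mulrBl coefB mulrBr ['X * P]mulrC; congr (_ - _).
    by rewrite coefCM mulrCA.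
  rewrite sumrB -mulr_sumr; congr (_ - _).
  rewrite big_ord_recr/= subnn coefMX eqxx mulr0 addr0.
  case: n => [|n]; first by rewrite big_ord0.
  by apply: eq_bigr => k _; rewrite coefMX subn_eq0 leqNgt ltn_ord/= subSn// -ltnS.
have : series (fun n => (a' n * t ^+ n : R[i]^o)) @ \oo -->
    (- z^-1 * B / (1 - t / z) : R[i]^o).
  apply: (cvg_affine_contraction
    (d := fun n => - z^-1 * series (fun n => (b n * t ^+ n : R[i]^o)) n)).
  - rewrite normrM normfV ltr_pdivrMr ?mul1r ?normr_gt0//; exact: lt_le_trans z1.
  - move=> n; rewrite /series/=.
    have -> : \sum_(0 <= k < n.+1) b k * t ^+ k =
        t * \sum_(0 <= k < n) a' k * t ^+ k - z * \sum_(0 <= k < n.+1) a' k * t ^+ k.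
      elim: n => [|n IHn].
        by rewrite !big_nat1 big_nil a'b mulr0 !sub0r mulNr mulrA.
      rewrite big_nat_recr//= IHn (a'b n.+1) [in RHS]big_nat_recr//=.
      rewrite [in - (z * \sum_(0 <= k < n.+2) _)]big_nat_recr//=.
      rewrite !mulrDr mulrBl opprD addrACA; congr (_ + _ + (_ + _)).
        by rewrite exprS mulrCA.
      by rewrite mulrA.
    by rewrite mulrBr !mulNr opprK mulKf// mulrA [z^-1 * t]mulrC addrAC addNr add0r.
  - by apply: cvgMr.
move/(IH a a' _ (fun x xr => rs1 x (@mem_behead _ (z :: rs) x xr)) (fun n => erefl)).
suff -> : - z^-1 * B / (1 - t / z) / P.[t] = B / (\prod_(z <- z :: rs) ('X - z%:P)).[t] by [].
rewrite big_cons hornerM !hornerE invfM !mulrA; congr (_ / _).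
have tz : t - z != 0.
  rewrite subr_eq0; apply: contraTneq z1 => <-.
  by rewrite -real_ltNge ?normr_real ?real1.
have -> : 1 - t / z = - (z^-1) * (t - z) by rewrite mulNr mulrBr mulVf// opprB mulrC.
by rewrite -mulf_div divff ?mul1r// oppr_eq0 invr_eq0.
Qed.

Lemma cvg_series_poly (R : realType) (b : {poly R[i]}) (t : R[i]) :
  series (fun n => (b`_n * t ^+ n : R[i]^o)) @ \oo --> (b.[t] : R[i]^o).
Proof.
apply: cvg_near_cst; exists (size b) => // n /= bn.
rewrite /series/= horner_coef (big_cat_nat (n := size b))//= [X in _ + X]big1_seq.
  by rewrite addr0 big_mkord.
by move=> k; rewrite mem_index_iota => /and3P[_ bk _]; rewrite nth_default// mul0r.
Qed.

(** Over the complex numbers [Q] splits with all roots of modulus at least 1; its leading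
    coefficient is absorbed into [b]. *)
Lemma cvg_series_ratio (R : realType) (Q b : {poly R[i]}) (a : nat -> R[i]) (t : R[i]) :
  `|t| < 1 -> (forall z, `|z| < 1 -> Q.[z] != 0) ->
  (forall n, \sum_(k < n.+1) a k * Q`_(n - k) = b`_n) ->
  series (fun n => (a n * t ^+ n : R[i]^o)) @ \oo --> (b.[t] / Q.[t] : R[i]^o).
Proof.
move=> t1 Q0 ab; have [rs rsE] := closed_field_poly_normal Q.
set c := lead_coef Q in rsE; set P := \prod_(z <- rs) _ in rsE.
have c0 : c != 0.
  rewrite lead_coef_eq0; apply: contraNneq (Q0 t t1) => ->.
  by rewrite horner0.
rewrite {1}rsE hornerZ invfM mulrA [b.[t] / c]mulrC -hornerZ.
apply: (cvg_series_poly_quotient (b := fun n => (c^-1 *: b)`_n)) => //.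
- move=> z zrs; rewrite real_leNgt ?real1 ?normr_real//; apply/negP => /Q0.
  by rewrite rsE hornerZ mulf_eq0 negb_or c0/= -/(root _ _) root_prod_XsubC zrs.
- move=> n; rewrite coefZ -ab mulr_sumr; apply: eq_bigr => k _.
  by rewrite rsE coefZ mulrCA mulKf.
- exact: cvg_series_poly.
Qed.

Theorem theorem5p6 (R : realType) (Phi : wedge) (p q : nat) :
  periodic_wedge Phi p q ->
  [set t : R[i] | `|t| < 1 /\ PGamma_at Phi t 0]
  = [set t : R[i] | `|t| < 1 /\ PGamma1 Phi p q t = 0].
Proof.
move=> Phi_per.
pose Q := \det (1%:M - 'X *: fwd_mx Phi_per R[i]).
pose b := \det (1%:M - 'X *: cover_mx Phi_per R[i]).
have Q0 z : `|z| < 1 -> Q.[z] != 0.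
  move=> z1; rewrite horner_det_enum_mx; apply: det_out_le1_neq0 => // u.
  by rewrite /fwd2; case: label2.
have ab n : \sum_(k < n.+1) (spec_coef Phi k)%:~R * Q`_(n - k) = b`_n.
  (* The first summand gives [k.*2 < N] for all [k <= n]; the second gives the congruence modulo
     ['X^n.+1], which determines the coefficient of index [n]. *)
  pose N := (n.+1.*2 + (n.+1 + (q + p).+2))%N.
  have := det_grid_fwd_cover Phi_per R[i] (leq_addl _ _ : (n.+1 + (q + p).+2 <= N)%N).
  rewrite -/Q -/b => /dvdpP[r /(congr1 (fun P : {poly R[i]} => P`_n))].
  rewrite coefMXn ltnSn coefB => /eqP; rewrite subr_eq0 => /eqP <-.
  rewrite coefMr; apply: eq_bigr => k _.
  rewrite mulrC (@spec_coef_grid _ _ _ Phi_per R[i] N)// /N.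
  by rewrite (leq_trans _ (leq_addr _ _))// ltn_double.
(* The series converges throughout the disk to this quotient, so by uniqueness of limits its zeros
   there are those of [b]. *)
have Pcvg t : `|t| < 1 -> PGamma_at Phi t (b.[t] / Q.[t]).
  by move=> t1; apply: cvg_series_ratio.
have bE t : `|t| < 1 -> (b.[t] == 0) = (PGamma1 Phi p q t == 0).
  by move=> t1; rewrite (PGamma1_eq0 Phi_per t1) horner_det_enum_mx.
apply/seteqP; split=> t /= [t1 Pt]; split=> //.
  have : b.[t] / Q.[t] = 0 by apply: (cvg_unique _ (Pcvg t t1) Pt).
  move/eqP; rewrite mulf_eq0 invr_eq0 (negPf (Q0 t t1)) orbF bE//.
  by move/eqP.
have := Pcvg t t1; suff -> : b.[t] = 0 by rewrite mul0r.
by apply/eqP; rewrite bE// Pt.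
Qed.
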